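(* Let $\Bbbk$ be an algebraically closed field of arbitrary characteristic and let $S=\Bbbk[x_1,x_2,x_3]$ with the standard grading. Let $F$ be a free graded $S$-module of finite rank $r$, let $K\subseteq F$ be a graded submodule, and suppose that the graded $S$-module $M=F/K$ has finite length $d$. Then $$\dim_{\Bbbk}\mathrm{Hom}_S(K,M)\equiv rd \pmod 2.$$
   Context: The standard grading on $S$ is the one with $\deg x_1=\deg x_2=\deg x_3=1$. A free graded $S$-module of rank $r$ is a free $S$-module with a basis of $r$ homogeneous elements of arbitrary integer degrees. $\mathrm{Hom}_S(K,M)$ denotes the space of all $S$-module homomorphisms $K\to M$, of any degree. *)

(* Defs.v *)
From HB Require Import structures.
From mathcomp Require Import all_boot all_order all_algebra.
From mathcomp Require Import mpoly.

Set Implicit Arguments.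
Unset Strict Implicit.
Unset Printing Implicit Defensive.

Import GRing.Theory.

Local Open Scope ring_scope.

Record submod_type (R : nzRingType) (V : lmodType R) (K : submodClosed V) :=
  SubmodType { submod_val :> V; _ : submod_val \in K }.

HB.instance Definition _ (R : nzRingType) (V : lmodType R)
    (K : submodClosed V) :=
  [isSub for @submod_val R V K].
HB.instance Definition _ (R : nzRingType) (V : lmodType R)
    (K : submodClosed V) :=
  [Choice of submod_type K by <:].
HB.instance Definition _ (R : nzRingType) (V : lmodType R)
    (K : submodClosed V) :=
  [SubChoice_isSubLmodule of submod_type K by <:].

(* [submodClosed] does not inherit from [zmodClosed], which the quotient of a
   Z-module requires. *)
Definition submod_zpred (R : nzRingType) (V : lmodType R)
  (K : submodClosed V) : V -> bool := fun v => v \in K.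

Lemma submod_zpred_closed (R : nzRingType) (V : lmodType R)
    (K : submodClosed V) :
  zmod_closed (submod_zpred K).
Proof.
split=> [|u v]; first exact: (rpred0 K).
change (u \in K -> v \in K -> u - v \in K) => Ku Kv.
by rewrite -scaleN1r rpredD ?rpredZ.
Qed.

HB.instance Definition _ (R : nzRingType) (V : lmodType R)
    (K : submodClosed V) :=
  GRing.isZmodClosed.Build V (submod_zpred K) (submod_zpred_closed K).

Definition submod_zmod (R : nzRingType) (V : lmodType R)
  (K : submodClosed V) : zmodClosed V :=
  GRing.ZmodClosed.clone V (submod_zpred K) _.

Definition quot_mod (R : nzRingType) (V : lmodType R) (K : submodClosed V) :=
  Quotient.quot (submod_zmod K).

HB.instance Definition _ (R : nzRingType) (V : lmodType R)
    (K : submodClosed V) :=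
  GRing.Zmodule.on (quot_mod K).

Definition quot_proj (R : nzRingType) (V : lmodType R) (K : submodClosed V)
  (v : V) : quot_mod K := (\pi_(Quotient.quot (submod_zmod K)) v)%qT.

Definition quot_scale (R : nzRingType) (V : lmodType R) (K : submodClosed V)
  (a : R) (x : quot_mod K) : quot_mod K :=
  quot_proj K (a *: repr (x : Quotient.quot (submod_zmod K))).

Lemma quot_projP (R : nzRingType) (V : lmodType R) (K : submodClosed V)
    (u v : V) :
  quot_proj K u = quot_proj K v <-> u - v \in K.
Proof.
rewrite (Quotient.idealrBE (submod_zmod K)); split=> [e|/eqP //]; exact/eqP.
Qed.

Lemma quot_projB (R : nzRingType) (V : lmodType R) (K : submodClosed V) :
  zmod_morphism (@quot_proj R V K).
Proof.
move=> u v; rewrite /quot_proj.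
exact: (raddfB (\pi_(Quotient.quot (submod_zmod K)))%qT).
Qed.

HB.instance Definition _ (R : nzRingType) (V : lmodType R)
    (K : submodClosed V) :=
  GRing.isZmodMorphism.Build V (quot_mod K) (@quot_proj R V K)
    (@quot_projB R V K).

Lemma quot_proj_surj (R : nzRingType) (V : lmodType R) (K : submodClosed V)
    (x : quot_mod K) : exists v : V, x = quot_proj K v.
Proof.
by exists (repr (x : Quotient.quot (submod_zmod K))); rewrite /quot_proj reprK.
Qed.

Lemma quot_scaleE (R : nzRingType) (V : lmodType R) (K : submodClosed V)
    (a : R) (v : V) :
  quot_scale a (quot_proj K v) = quot_proj K (a *: v).
Proof.
apply/quot_projP; rewrite -scalerBr; apply: rpredZ; apply/quot_projP.
by rewrite /quot_proj reprK.
Qed.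

Lemma quot_scaleA (R : nzRingType) (V : lmodType R) (K : submodClosed V)
    (a b : R) (x : quot_mod K) :
  quot_scale a (quot_scale b x) = quot_scale (a * b) x.
Proof. by have [v ->] := quot_proj_surj x; rewrite !quot_scaleE scalerA. Qed.

Lemma quot_scale1 (R : nzRingType) (V : lmodType R) (K : submodClosed V) :
  left_id 1 (@quot_scale R V K).
Proof.
by move=> x; have [v ->] := quot_proj_surj x; rewrite quot_scaleE scale1r.
Qed.

Lemma quot_scaleDr (R : nzRingType) (V : lmodType R) (K : submodClosed V) :
  right_distributive (@quot_scale R V K) +%R.
Proof.
move=> a x y; have [u ->] := quot_proj_surj x.
have [v ->] := quot_proj_surj y.
by rewrite -raddfD !quot_scaleE scalerDr raddfD.
Qed.

Lemma quot_scaleDl (R : nzRingType) (V : lmodType R) (K : submodClosed V)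
    (x : quot_mod K) :
  {morph (fun a : R => quot_scale a x) : a b / a + b}.
Proof.
move=> a b; have [v ->] := quot_proj_surj x.
by rewrite !quot_scaleE scalerDl raddfD.
Qed.

HB.instance Definition _ (R : nzRingType) (V : lmodType R)
    (K : submodClosed V) :=
  GRing.Zmodule_isLmodule.Build R (quot_mod K)
    (@quot_scaleA R V K) (@quot_scale1 R V K)
    (@quot_scaleDr R V K) (@quot_scaleDl R V K).

Lemma quot_projZ (R : nzRingType) (V : lmodType R) (K : submodClosed V) :
  scalable (@quot_proj R V K).
Proof. by move=> a v; rewrite -quot_scaleE. Qed.

HB.instance Definition _ (R : nzRingType) (V : lmodType R)
    (K : submodClosed V) :=
  GRing.isScalable.Build R V (quot_mod K) *:%R (@quot_proj R V K)
    (@quot_projZ R V K).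

(* By the correspondence theorem, this says that B / A is simple. *)
Definition covers (R : nzRingType) (V : lmodType R) (A B : submodClosed V) :
    Prop :=
  [/\ {subset A <= B}, ~ (A =i B)
    & forall C : submodClosed V,
        {subset A <= C} -> {subset C <= B} -> C =i A \/ C =i B].

(* V has a composition series of length d; only N 0, ..., N d matter. *)
Definition has_length (R : nzRingType) (V : lmodType R) (d : nat) : Prop :=
  exists N : nat -> submodClosed V,
    [/\ N 0 =i pred1 (0 : V), N d =i predT
      & forall i : nat, (i < d)%N -> covers (N i) (N i.+1)].

Definition is_basis (R : nzRingType) (V : lmodType R) (r : nat)
    (e : 'I_r -> V) : Prop :=
  forall v : V, exists! c : 'rV[R]_r, v = \sum_(i < r) c 0 i *: e i.

(* G n is the component of degree n of V, for the standard grading of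
   k[x_1, ..., x_m]. *)
Record is_grading (k : fieldType) (m : nat) (V : lmodType {mpoly k[m]})
    (G : int -> {pred V}) : Prop := IsGrading {
  grading_closed : forall n : int, zmod_closed (G n);
  grading_scale : forall (i : nat) (n : int) (p : {mpoly k[m]}) (v : V),
    p \is i.-homog -> v \in G n -> p *: v \in G (i%:Z + n);
  grading_span : forall v : V, exists (s : seq int) (w : int -> V),
    (forall n : int, w n \in G n) /\ v = \sum_(n <- s) w n;
  grading_direct : forall (s : seq int) (w : int -> V),
    uniq s -> (forall n : int, w n \in G n) -> \sum_(n <- s) w n = 0 ->
    forall n : int, n \in s -> w n = 0
}.

Definition graded_free (k : fieldType) (m : nat) (V : lmodType {mpoly k[m]})
    (G : int -> {pred V}) (r : nat) : Prop :=
  is_grading G /\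
  exists e : 'I_r -> V,
    is_basis e /\ forall i : 'I_r, exists n : int, e i \in G n.

Definition graded_submod (k : fieldType) (m : nat)
    (V : lmodType {mpoly k[m]}) (G : int -> {pred V}) (K : submodClosed V) :
    Prop :=
  forall v : V, v \in K -> exists (s : seq int) (w : int -> V),
    (forall n : int, w n \in G n /\ w n \in K) /\ v = \sum_(n <- s) w n.

(* The k-vector space of all module homomorphisms V -> W, with scalars acting
   through constant polynomials, has a basis of n elements. *)
Definition hom_dim (k : fieldType) (m : nat) (V W : lmodType {mpoly k[m]})
    (n : nat) : Prop :=
  exists b : 'I_n -> {linear V -> W},
    forall f : {linear V -> W}, exists! c : 'rV[k]_n,
      forall v : V, f v = \sum_(i < n) (c 0 i)%:MP *: b i v.

(* Main.v *)
Require Import Defs.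
From HB Require Import structures.
From mathcomp Require Import all_boot all_order all_algebra.
From mathcomp Require Import mpoly ring zify.
From Stdlib Require Import ClassicalEpsilon.

(** Write M = F / K, and let X_1, X_2, X_3 be the commuting matrices by which
    the variables act on M.

    Dimension of M. The variables act nilpotently on M: the images of the powers
    of a variable stabilize because M has finite length, while degrees in M are
    bounded below ([graded_finite_length_nilpotent]). Hence they act as zero on
    every composition factor, the factors are one-dimensional, and M has
    dimension d ([length_basis]), with a basis of homogeneous elements
    ([homogeneous_coordinates]).

    Reduction to matrices. Let Z be the space of triples (A_1, A_2, A_3) of
    endomorphisms of the vector space M with [X_i, A_j] = [X_j, A_i]. Such a
    triple and a vector w in M^r deform to first order the module M and the
    images of the basis of F; the first-order part Phi : F -> M of the deformed
    quotient map is determined by Phi (x_j v) = x_j Phi v + A_j v and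
    Phi e_i = w_i, and it restricts to a homomorphism K -> M. Every homomorphism
    arises so, and the parameters giving zero are those of the infinitesimal
    changes of basis of M, one for each endomorphism. Therefore
    dim Hom(K, M) + d^2 = r d + dim Z ([hom_dim_cocycles]).

    Parity. Z is the kernel of the curl
    (A_i) |-> ([X_2, A_3] - [X_3, A_2], [X_3, A_1] - [X_1, A_3],
    [X_1, A_2] - [X_2, A_1]) on a space of dimension 3 d^2. The curl is
    self-adjoint for the trace form, so its rank is that of a symmetric bilinear
    form. As the X_i have degree 1, this form pairs triples of degree n only
    with triples of degree -1 - n, and exactly one of these two degrees is
    nonnegative; so its Gram matrix is block antidiagonal with two mutually
    transposed blocks, and its rank is even.
    Hence dim Z is congruent to d^2 ([cocycles_parity]), and dim Hom(K, M)
    to r d. *)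

Set Implicit Arguments.
Unset Strict Implicit.
Unset Printing Implicit Defensive.

Import Order.TTheory GRing.Theory Num.Theory.

Local Open Scope ring_scope.

(** * Composition series and nilpotent variables *)

(** The induction suited to modules, where the action of the variables is what
    is known. *)
Lemma mpoly_var_ind (k : fieldType) (m : nat) (P : {mpoly k[m]} -> Prop) :
  (forall c : k, P c%:MP) ->
  (forall p q : {mpoly k[m]}, P p -> P q -> P (p + q)) ->
  (forall (j : 'I_m) (p : {mpoly k[m]}), P p -> P ('X_j * p)) ->
  forall p : {mpoly k[m]}, P p.
Proof.
move=> PC PD PX.
have PM (mo : 'X_{1..m}) : forall q, P q -> P ('X_[mo] * q).
  rewrite mpolyXE_id.
  apply: (big_ind (fun p : {mpoly k[m]} => forall q, P q -> P (p * q))).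
  - by move=> q; rewrite mul1r.
  - by move=> p1 p2 IH1 IH2 q Pq; rewrite -mulrA; apply/IH1/IH2.
  - move=> i _; elim: (mo i) => [|e IHe] q Pq; first by rewrite expr0 mul1r.
    by rewrite exprS -mulrA; apply/PX/IHe.
elim/mpolyind=> [|c mo p _ _ Pp]; first by rewrite -mpolyC0; apply: PC.
by apply: PD => //; rewrite -mul_mpolyC mulrC; apply/PM/PC.
Qed.

(** Submodules are boolean predicates; excluded middle lets them be cut out by
    arbitrary propositions. *)
Lemma submod_of_prop (R : nzRingType) (V : lmodType R) (P : V -> Prop) :
  P 0 -> (forall a u v, P u -> P v -> P (a *: u + v)) ->
  exists C : submodClosed V, forall v, v \in C <-> P v.
Proof.
move=> P0 Plin.
pose p v : bool := if excluded_middle_informative (P v) then true else false.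
have pP v : v \in p <-> P v.
  rewrite unfold_in /p; by case: excluded_middle_informative.
have pcl : submod_closed p.
  split; first exact/pP.
  by move=> a u v /pP Pu /pP Pv; apply/pP/Plin.
pose C : submodClosed V := HB.pack p (GRing.isSubmodClosed.Build R V p pcl).
by exists C.
Qed.

(** The image [p B + A] is a submodule between [A] and [B], so it is one of
    them: every scalar acts on a simple quotient as zero or surjectively. *)
Lemma covers_dichotomy (R : comNzRingType) (V : lmodType R)
    (A B : submodClosed V) (p : R) :
  covers A B ->
  (forall v, v \in B -> p *: v \in A) \/
  (forall v, v \in B -> exists w u, [/\ w \in B, u \in A & v = p *: w + u]).
Proof.
case=> sAB _ maxB.
have [||C CP] := @submod_of_prop R V
  (fun v => exists w u, [/\ w \in B, u \in A & v = p *: w + u]).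
- by exists 0, 0; rewrite scaler0 addr0 !rpred0.
- move=> a _ _ [w [u [Bw Au ->]]] [w' [u' [Bw' Au' ->]]].
  exists (a *: w + w'), (a *: u + u'); split; try by rewrite rpredD ?rpredZ.
  by rewrite !scalerDr !scalerA (mulrC p a) addrACA.
case: (maxB C) => [v Av|v /CP[w [u [Bw Au ->]]]|CA|CB].
- by apply/CP; exists 0, v; rewrite scaler0 add0r rpred0.
- by rewrite rpredD ?rpredZ// sAB.
- left=> v Bv; rewrite -CA; apply/CP.
  by exists v, 0; rewrite addr0 rpred0.
- by right=> v; rewrite -CB => /CP.
Qed.

(** The Fitting argument along a composition series: each factor on which [p]
    acts as zero delays the stabilization of the images [p^i V] by at most one
    step, and the factors on which [p] is surjective do not delay it. *)
Lemma power_image_stabilizes (R : comNzRingType) (V : lmodType R) (d : nat)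
    (p : R) :
  has_length V d ->
  forall (m : nat) (v : V), exists w, p ^+ d *: v = p ^+ (d + m) *: w.
Proof.
move=> [N [N0 Nd Ncov]].
have stab i : (i <= d)%N -> forall v, v \in N i ->
    exists2 w, w \in N i & p ^+ i *: v = p ^+ i.+1 *: w.
  elim: i => [_ v|i IHi lid v Nv].
    by rewrite N0 inE => /eqP->; exists 0; rewrite ?rpred0 // !scaler0.
  have [sN _ _] := Ncov i lid.
  have [zero|surj] := covers_dichotomy p (Ncov i lid).
    have [w1 Nw1 e1] := IHi (ltnW lid) _ (zero v Nv).
    have [w2 Nw2 e2] := IHi (ltnW lid) _ Nw1.
    exists w2; first exact: sN.
    by rewrite exprSr -scalerA e1 exprS -scalerA e2 scalerA -exprS.
  have [w [u [Nw Nu ->]]] := surj v Nv.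
  have [w' Nw' e] := IHi (ltnW lid) _ Nu.
  exists (w + w'); first by rewrite rpredD // sN.
  rewrite scalerDr [in RHS]scalerDr scalerA -exprSr; congr (_ + _).
  by rewrite exprS -scalerA e scalerA -exprS.
elim=> [|m IHm] v; first by exists v; rewrite addn0.
have [w ->] := IHm v; have [|w' _ e] := stab d (leqnn d) w; first by rewrite Nd.
by exists w'; rewrite addnC exprD -scalerA e scalerA -exprD !addnS addnC.
Qed.

(** A variable acting nilpotently cannot be surjective on the simple quotient
    [B / A], hence kills it; so a polynomial acts there through its constant
    term. *)
Lemma covers_scalar (k : fieldType) (m : nat) (V : lmodType {mpoly k[m]})
    (A B : submodClosed V) :
  covers A B ->
  (forall j : 'I_m, exists N : nat, forall v : V, 'X_j ^+ N *: v = 0) ->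
  forall p : {mpoly k[m]}, exists c : k,
    forall v, v \in B -> p *: v - c%:MP *: v \in A.
Proof.
move=> covAB nilX; have [sAB neAB _] := covAB.
have X0 (j : 'I_m) v : v \in B -> 'X_j *: v \in A.
  move: v; have [//|surj] := covers_dichotomy 'X_j covAB.
  have [N nilN] := nilX j; case: neAB => v; apply/idP/idP => [/sAB//|Bv].
  have: exists2 w, w \in B & v - 'X_j ^+ N *: w \in A.
    elim: N {nilN} => [|N [w Bw Aw]].
      by exists v; rewrite // expr0 scale1r subrr rpred0.
    have [w' [u [Bw' Au ew]]] := surj w Bw; exists w' => //.
    rewrite exprSr -scalerA (_ : v - _ = v - 'X_j ^+ N *: w + 'X_j ^+ N *: u).
      by rewrite rpredD ?rpredZ.
    by rewrite ew scalerDr opprD addrA subrK.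
  by case=> w _; rewrite nilN subr0.
elim/mpoly_var_ind=> [c|p q [a pa] [b qb]|j p [a pa]].
- by exists c => v _; rewrite subrr rpred0.
- exists (a + b) => v Bv; rewrite rmorphD /= !scalerDl opprD addrACA.
  by rewrite rpredD ?pa ?qb.
- exists 0 => v Bv; rewrite mpolyC0 scale0r subr0 mulrC -scalerA.
  by rewrite rpredZ ?X0.
Qed.

(** Length equals dimension once the variables act nilpotently: by
    [covers_scalar] every subspace between consecutive terms of a composition
    series is a submodule, so the factors are lines, and one vector chosen in
    each of them gives a basis. *)
Lemma length_basis (k : fieldType) (m : nat) (V : lmodType {mpoly k[m]})
    (d : nat) :
  has_length V d ->
  (forall j : 'I_m, exists N : nat, forall v : V, 'X_j ^+ N *: v = 0) ->
  exists b : 'I_d -> V, forall v : V, exists! c : 'rV[k]_d,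
    v = \sum_(i < d) (c 0 i)%:MP *: b i.
Proof.
move=> [N [N0 Nd Ncov]] nilX.
(* A vector spanning [N i.+1] modulo [N i]. *)
have step i : exists b : V, (i < d)%N ->
    [/\ b \in N i.+1, b \notin N i &
        forall v, v \in N i.+1 -> exists c : k, v - c%:MP *: b \in N i].
  have [lid|] := boolP (i < d)%N; last by exists 0.
  have [sN neN maxN] := Ncov i lid.
  have sc := covers_scalar (Ncov i lid) nilX.
  have [b Nb nNb] : exists2 b, b \in N i.+1 & b \notin N i.
    apply: NNPP => none; apply: neN => v; apply/idP/idP => [/sN//|Nv].
    by apply/negPn/negP => nNv; apply: none; exists v.
  exists b => _; split=> //.
  have [||C CP] := @submod_of_prop _ V (fun v => v \in N i.+1 /\
      exists c : k, v - c%:MP *: b \in N i).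
  - by split; [rewrite rpred0 | exists 0; rewrite mpolyC0 scale0r subr0 rpred0].
  - move=> p u v [Nu [a ua]] [Nv [c vc]].
    split; first by rewrite rpredD ?rpredZ.
    (* [p] acts on [N i.+1] modulo [N i] as the scalar [e]. *)
    have [e pe] := sc p; exists (e * a + c).
    rewrite rmorphD rmorphM /= scalerDl opprD addrACA rpredD //.
    have -> : p *: u - (e%:MP * a%:MP) *: b =
        (p *: u - e%:MP *: u) + e%:MP *: (u - a%:MP *: b).
      by rewrite scalerBr scalerA addrA subrK.
    by rewrite rpredD ?pe ?rpredZ.
  case: (maxN C) => [v Nv|v /CP[]//|CA|CB v].
  - apply/CP; split; first exact: sN.
    by exists 0; rewrite mpolyC0 scale0r subr0.
  - case/negP: nNb; rewrite -CA; apply/CP; split=> //.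
    by exists 1; rewrite mpolyC1 scale1r subrr rpred0.
  - by rewrite -CB => /CP[].
have [b bP] := ClassicalEpsilon.choice _ step.
have span i : (i <= d)%N -> forall v, v \in N i -> exists c : nat -> k,
    v = \sum_(a < i) (c a)%:MP *: b a.
  elim: i => [_ v|i IHi lid v Nv].
    by rewrite N0 inE => /eqP->; exists (fun=> 0); rewrite big_ord0.
  have [_ _ /(_ v Nv)[c /(IHi (ltnW lid))[e ve]]] := bP i lid.
  exists (fun a => if a == i then c else e a); rewrite big_ord_recr /= eqxx.
  apply: (canRL (subrK _)); rewrite ve; apply: eq_bigr => a _.
  by rewrite ltn_eqF.
have inN i (c : nat -> k) : (i <= d)%N -> \sum_(a < i) (c a)%:MP *: b a \in N i.
  elim: i => [_|i IHi lid]; first by rewrite big_ord0 rpred0.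
  have [sN _ _] := Ncov i lid; have [Nb _ _] := bP i lid.
  rewrite big_ord_recr /= rpredD //; last exact: rpredZ.
  exact/sN/IHi/ltnW.
have indep i (c : nat -> k) : (i <= d)%N ->
    \sum_(a < i) (c a)%:MP *: b a = 0 -> forall a, (a < i)%N -> c a = 0.
  elim: i => [//|i IHi lid]; rewrite big_ord_recr /= => e0.
  have [_ nNb _] := bP i lid.
  have ci : c i = 0.
    apply/eqP/negPn/negP => nz; case/negP: nNb.
    have -> : b i = (- (c i)^-1)%:MP *: \sum_(a < i) (c a)%:MP *: b a.
      rewrite (canRL (addrK _) e0) add0r scalerN -scaleNr scalerA -rmorphN.
      by rewrite opprK -rmorphM mulVf // rmorph1 scale1r.
    by rewrite rpredZ; [|exact: inN (ltnW lid)].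
  move=> a; rewrite ltnS leq_eqVlt => /predU1P[->//|].
  apply: IHi (ltnW lid) _ a.
  by rewrite ci mpolyC0 scale0r addr0 in e0.
exists (fun i : 'I_d => b i) => v.
have [|c vc] := span d (leqnn d) v; first by rewrite Nd.
exists (\row_(a < d) c a); split.
  by rewrite vc; apply: eq_bigr => a _; rewrite mxE.
move=> c' vc'; apply/rowP => a; rewrite mxE.
have: \sum_(a < d) (c a - (if insub (a : nat) is Some a' then c' 0 a' else 0))%:MP
    *: b a = 0.
  transitivity (v - v); last exact: subrr.
  rewrite [in X in _ = X - _]vc vc' -sumrB; refine (eq_bigr _ _) => i _.
  by rewrite valK rmorphB scalerBl.
move/(indep d (fun a => c a - (if insub a is Some a' then c' 0 a' else 0)) (leqnn d)).
by move=> /(_ a (ltn_ord a))/eqP; rewrite valK subr_eq0 => /eqP.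
Qed.

(** * Homogeneous components *)

(** The projections [pr n] onto the homogeneous components. They are first
    found as functions [n |-> f n] that sum to the vector over every large
    enough duplicate-free list of degrees; this form is stable under
    subtraction, which reduces their uniqueness to [grading_direct]. *)
Lemma homogeneous_components (k : fieldType) (m : nat)
    (V : lmodType {mpoly k[m]}) (G : int -> {pred V}) :
  is_grading G ->
  exists pr : int -> V -> V,
    [/\ forall n u v, pr n (u - v) = pr n u - pr n v,
        forall n v, pr n v \in G n &
        forall n n' v, v \in G n' -> pr n v = if n' == n then v else 0].
Proof.
move=> gr.
have G0 n : 0 \in G n by case: (grading_closed gr n).
have GB n u v : u \in G n -> v \in G n -> u - v \in G n.
  by case: (grading_closed gr n) => _; apply.
have GN n u : u \in G n -> - u \in G n.
  by move=> Gu; rewrite -[- u]add0r GB.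
have GD n u v : u \in G n -> v \in G n -> u + v \in G n.
  by move=> Gu Gv; rewrite -[v]opprK GB ?GN.
pose dec v (f : int -> V) := (forall n, f n \in G n) /\
  exists s : seq int, forall t, uniq t -> {subset s <= t} ->
    v = \sum_(n <- t) f n.
have decB u v f g : dec u f -> dec v g -> dec (u - v) (fun n => f n - g n).
  move=> [Gf [s sf]] [Gg [s' sg]]; split=> [n|]; first exact: GB.
  exists (s ++ s') => t ut st; rewrite sumrB -(sf t) -?(sg t) // => x xs.
    by apply: st; rewrite mem_cat xs orbT.
  by apply: st; rewrite mem_cat xs.
have dec0 f : dec 0 f -> forall n, f n = 0.
  move=> [Gf [s sf]] n; pose t := undup (n :: s).
  apply: (grading_direct gr (s := t)) => //; first exact: undup_uniq.
    rewrite -(sf t) ?undup_uniq // => x xs.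
    by rewrite mem_undup inE xs orbT.
  by rewrite mem_undup inE eqxx.
have dec_ex v : exists f, dec v f.
  have [s [w [Gw ->]]] := grading_span gr v.
  (* The given decomposition may list a degree several times. *)
  exists (fun n => \sum_(i <- s | i == n) w i); split=> [n|].
    apply: (big_ind (fun x => x \in G n)) => // [u u'|i /eqP <- //].
    exact: GD.
  exists s => t ut st; rewrite (exchange_big_dep predT) //=.
  rewrite [LHS]big_seq [RHS]big_seq; apply: eq_bigr => i si; rewrite -big_filter.
  have -> : [seq n <- t | i == n] = [:: i].
    rewrite (eq_filter (a2 := pred1 i)) => [|n]; last by rewrite eq_sym.
    by apply: filter_pred1_uniq => //; apply: st.
  by rewrite big_seq1.
have [c decc] := ClassicalEpsilon.choice _ dec_ex.
have dec_eq v f n : dec v f -> c v n = f n.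
  move=> df; apply/eqP; rewrite -subr_eq0; apply/eqP.
  by have := decB _ _ _ _ (decc v) df; rewrite subrr => /dec0.
exists (fun n v => c v n); split=> [n u v|n v|n n' v Gv].
- by apply: (@dec_eq _ (fun n => c u n - c v n)); apply: decB.
- by case: (decc v).
- rewrite (@dec_eq v (fun n => if n' == n then v else 0)) //.
  split=> [i|]; first by case: eqP => [<-|].
  exists [:: n'] => t ut st; rewrite -big_mkcond /= -big_filter.
  rewrite (eq_filter (a2 := pred1 n')) => [|i]; last by rewrite eq_sym.
  by rewrite filter_pred1_uniq ?big_seq1 // st // inE.
Qed.

Section Grading.
Context (k : fieldType) (m : nat) (F : lmodType {mpoly k[m]}).
Context (G : int -> {pred F}) (pr : int -> F -> F).
Hypothesis gr : is_grading G.
Hypothesis prB : forall n u v, pr n (u - v) = pr n u - pr n v.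
Hypothesis prG : forall n v, pr n v \in G n.
Hypothesis prE : forall n n' v, v \in G n' -> pr n v = if n' == n then v else 0.

Lemma component0 n : pr n 0 = 0.
Proof. by rewrite -{1}(subrr 0) prB subrr. Qed.

Lemma componentD n u v : pr n (u + v) = pr n u + pr n v.
Proof. by rewrite -{1}[v]opprK prB -[- v]add0r prB component0 add0r opprK. Qed.

Lemma component_sum n (I : Type) (s : seq I) (P : pred I) (w : I -> F) :
  pr n (\sum_(i <- s | P i) w i) = \sum_(i <- s | P i) pr n (w i).
Proof. by apply: big_morph; [exact: componentD | exact: component0]. Qed.

Lemma component_id n v : v \in G n -> pr n v = v.
Proof. by move=> Gv; rewrite (prE _ Gv) eqxx. Qed.

Lemma componentZ_homog n (i : nat) (p : {mpoly k[m]}) v :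
  p \is i.-homog -> pr (i%:Z + n) (p *: v) = p *: pr n v.
Proof.
move=> hp; have [s [w [Gw ->]]] := grading_span gr v.
rewrite scaler_sumr !component_sum scaler_sumr; apply: eq_bigr => j _.
rewrite (prE _ (grading_scale gr hp (Gw j))) (prE _ (Gw j)) (inj_eq (addrI _)).
by case: eqP; rewrite ?scaler0.
Qed.

Lemma component_graded_submod (K : submodClosed F) n v :
  graded_submod G K -> v \in K -> pr n v \in K.
Proof.
move=> grK /grK[s [w [Gw ->]]]; rewrite component_sum rpred_sum // => i _.
have [Gi Ki] := Gw i; rewrite (prE _ Gi).
by case: ifP; rewrite ?rpred0.
Qed.

(** Polynomials have no components of negative degree, so a finite basis bounds
    the degrees of a free module from below. *)
Lemma graded_free_bounded_below r :
  graded_free G r ->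
  exists n0 : int, forall n v, n < n0 -> v \in G n -> v = 0.
Proof.
move=> [_ [e [be /fin_all_exists[n Ge]]]].
exists (- \sum_(i < r) `|n i|) => j v lj Gv.
have [c [vc _]] := be v; rewrite -(component_id Gv) vc component_sum big1 // => i _.
have le_ji : j < n i.
  apply: lt_le_trans lj _; rewrite lerNl (bigD1 i) //=.
  apply: (@le_trans _ _ `|n i|); first by rewrite -normrN ler_norm.
  by rewrite lerDl sumr_ge0.
rewrite [c 0 i]mpolyE scaler_suml component_sum big1 // => mo _.
have hX : (c 0 i)@_mo *: 'X_[mo] \is (mdeg mo).-homog.
  by rewrite dhomogZ ?dhomogX.
rewrite (prE _ (grading_scale gr hX (Ge i))).
by case: eqP => // e1; move: le_ji; rewrite -e1 ltNge lerDr.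
Qed.

End Grading.

(** By stabilization of the images of [x = 'X_j], a homogeneous [v] of degree
    [n] satisfies [x^d v = x^(d+i) w] for every [i]. Taking components replaces
    [w] by its component of degree [n - i], which is zero for large [i] as the
    degrees are bounded below. *)
Lemma graded_finite_length_nilpotent (k : fieldType) (m : nat)
    (F : lmodType {mpoly k[m]}) (G : int -> {pred F}) (r : nat)
    (K : submodClosed F) (d : nat) (j : 'I_m) :
  graded_free G r -> graded_submod G K -> has_length (quot_mod K) d ->
  forall x : quot_mod K, 'X_j ^+ d *: x = 0.
Proof.
move=> frG grK lenK x; have [gr _] := frG.
have [pr [prB prG prE]] := homogeneous_components gr.
have homX i : ('X_j ^+ i : {mpoly k[m]}) \is i.-homog.
  by rewrite -{2}[i]mul1n dhomogMn // dhomogX /= mdeg1.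
have [n0 bd] := graded_free_bounded_below gr prB prE frG.
have [v ->] := quot_proj_surj x; rewrite -linearZ -(linear0 (quot_proj K)).
apply/quot_projP; rewrite subr0.
have [s [w [Gw ->]]] := grading_span gr v.
rewrite scaler_sumr rpred_sum // => n _.
(* Large enough for [n - i < n0]. *)
pose i := `|n - n0|.+1%N.
have [y ey] := power_image_stabilizes 'X_j lenK i (quot_proj K (w n)).
have [u eu] := quot_proj_surj y; rewrite {}eu -!linearZ in ey.
have /(component_graded_submod prB prE (d%:Z + n) grK) := (quot_projP _ _ _).1 ey.
rewrite prB (componentZ_homog gr prB prE _ _ (homX d)) (component_id prE (Gw n)).
have -> : d%:Z + n = (d + i)%:Z + (n - i%:Z).
  by rewrite PoszD addrACA subrr addr0.
have small : n - i%:Z < n0.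
  rewrite ltrBlDr -ltrBlDl /i -addn1 PoszD.
  by rewrite (le_lt_trans (ler_norm _)) // -abszE ltrDl.
rewrite (componentZ_homog gr prB prE _ _ (homX _)) (bd _ _ small (prG _ _)).
by rewrite scaler0 subr0.
Qed.

(** * Coordinates on F / K *)

(** Modules over the polynomial ring carry no [k]-module structure of their own,
    so linearity over [k] is expressed by constant polynomials. *)
Definition klinear (k : fieldType) (m n : nat) (V : lmodType {mpoly k[m]})
    (h : V -> 'rV[k]_n) : Prop :=
  forall c u v, h (c%:MP *: u + v) = c *: h u + h v.

Section Klinear.
Context (k : fieldType) (m n : nat) (V : lmodType {mpoly k[m]}).
Context (h : V -> 'rV[k]_n).
Hypothesis hL : klinear h.

Lemma klin0 : h 0 = 0.
Proof.
have := hL (-1) 0 0; rewrite scaler0 addr0 scaleN1r => /(congr1 (+%R (h 0))).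
by rewrite addrA subrr add0r => e; apply: (addIr (h 0)); rewrite e add0r.
Qed.

Lemma klinZ c u : h (c%:MP *: u) = c *: h u.
Proof. by have := hL c u 0; rewrite !addr0 klin0 addr0. Qed.

Lemma klinD u v : h (u + v) = h u + h v.
Proof. by have := hL 1 u v; rewrite mpolyC1 !scale1r. Qed.

Lemma klinB u v : h (u - v) = h u - h v.
Proof. by apply: (canRL (addrK _)); rewrite -klinD subrK. Qed.

Lemma klin_sum (I : Type) (s : seq I) (P : pred I) (w : I -> V) :
  h (\sum_(i <- s | P i) w i) = \sum_(i <- s | P i) h (w i).
Proof. by apply: big_morph; [exact: klinD | exact: klin0]. Qed.
End Klinear.

Lemma quotient_coordinates (k : fieldType) (m : nat)
    (F : lmodType {mpoly k[m]}) (K : submodClosed F) d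
    (b : 'I_d -> quot_mod K) :
  (forall x : quot_mod K, exists! c : 'rV[k]_d, x = \sum_(i < d) (c 0 i)%:MP *: b i) ->
  exists q : F -> 'rV[k]_d, [/\ klinear q, forall v, q v = 0 <-> v \in K &
    forall c, exists v, q v = c].
Proof.
move=> bb.
have [q qP] := ClassicalEpsilon.choice _ (fun v => bb (quot_proj K v)).
have qE v : quot_proj K v = \sum_(i < d) (q v 0 i)%:MP *: b i by case: (qP v).
have qU v (c : 'rV[k]_d) : quot_proj K v = \sum_(i < d) (c 0 i)%:MP *: b i -> q v = c.
  by case: (qP v) => _; apply.
have q0 : q 0 = 0.
  by apply: qU; rewrite linear0 big1 // => i _; rewrite mxE mpolyC0 scale0r.
exists q; split=> [c u v|v|c].
- apply: qU; rewrite linearD linearZ /= !qE scaler_sumr -big_split /=.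
  apply: eq_bigr => i _.
  by rewrite !mxE rmorphD rmorphM /= scalerDl scalerA.
- have -> : v \in K <-> quot_proj K v = quot_proj K 0.
    by split=> [Kv|/quot_projP]; [apply/quot_projP|]; rewrite subr0.
  split=> [e|e]; last by rewrite (qU v 0) // e -q0 qE.
  by rewrite !qE e q0.
- have [v ev] := quot_proj_surj (\sum_(i < d) (c 0 i)%:MP *: b i).
  by exists v; apply: qU.
Qed.

Section HomogeneousCoordinates.
Context (k : fieldType) (m : nat) (F : lmodType {mpoly k[m]}).
Context (G : int -> {pred F}) (K : submodClosed F) (d : nat).
Context (q0 : F -> 'rV[k]_d).
Hypothesis gr : is_grading G.
Hypothesis grK : graded_submod G K.
Hypothesis q0L : klinear q0.
Hypothesis q0K : forall v, q0 v = 0 <-> v \in K.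
Hypothesis q0S : forall c, exists v, q0 v = c.

(** A basis of [F / K] made of classes of homogeneous elements: the components
    of lifts of any basis span, and a basis is extracted from them. Since [K]
    is graded, the coordinates of a homogeneous element are then supported on
    the basis vectors of its degree. *)
Lemma homogeneous_coordinates :
  exists (q : F -> 'rV[k]_d) (f : 'I_d -> F) (deg : 'I_d -> int),
    [/\ klinear q, forall v, q v = 0 <-> v \in K,
        forall a, q (f a) = delta_mx 0 a, forall a, f a \in G (deg a) &
        forall n v a, v \in G n -> q v 0 a != 0 -> deg a = n].
Proof.
have [pr [prB prG prE]] := homogeneous_components gr.
have [v vE] := ClassicalEpsilon.choice _ (fun a : 'I_d => q0S (delta_mx 0 a)).
have [s /ClassicalEpsilon.choice[w vsw]] :=
  ClassicalEpsilon.choice _ (fun a => grading_span gr (v a)).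
pose L := [seq (n, w a n) | a <- enum 'I_d, n <- s a].
pose A := \matrix_(i < size L) q0 (nth (0, 0) L i).2.
have LG i : (i < size L)%N -> (nth (0, 0) L i).2 \in G (nth (0, 0) L i).1.
  move=> /(mem_nth (0, 0)) /allpairsPdep[a [n [_ _ ->]]] /=.
  by have [] := vsw a.
have fullA : row_full A.
  rewrite -sub1mx; apply/row_subP => a; rewrite rowE mulmx1 -vE.
  have [_ ->] := vsw a; rewrite (klin_sum q0L) big_seq.
  apply: summx_sub => n sn.
  have Ln : (n, w a n) \in L.
    by apply: allpairs_f_dep => //; rewrite mem_enum.
  have iL : (index (n, w a n) L < size L)%N by rewrite index_mem.
  suff -> : q0 (w a n) = row (Ordinal iL) A by exact: row_sub.
  by rewrite rowK nth_index.
pose g := fullrankfun fullA; pose B := rowsub g A.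
have uB : B \in unitmx by exact: fullrowsub_unit.
pose q v := q0 v *m invmx B.
pose f a := (nth (0, 0) L (g a)).2; pose deg a := (nth (0, 0) L (g a)).1.
have qL : klinear q.
  by move=> c u u'; rewrite /q q0L mulmxDl scalemxAl.
have qK u : q u = 0 <-> u \in K.
  rewrite -q0K; split=> [|e]; last by rewrite /q e mul0mx.
  by move/(congr1 (mulmx^~ B)); rewrite mulmxKV // mul0mx.
have qf a : q (f a) = delta_mx 0 a.
  rewrite /q (_ : q0 (f a) = row a B); last by rewrite row_rowsub rowK.
  by rewrite -row_mul mulmxV // rowE mulmx1.
have fG a : f a \in G (deg a) by exact: LG.
exists q, f, deg; split=> // n u a Gu.
have : u - \sum_a (q u 0 a)%:MP *: f a \in K.
  apply/qK; rewrite (klinB qL) (klin_sum qL) {1}[q u]row_sum_delta.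
  apply/eqP; rewrite subr_eq0; apply/eqP; apply: eq_bigr => i _.
  by rewrite (klinZ qL) qf.
move/(component_graded_submod prB prE n grK)/qK.
rewrite prB (klinB qL) (component_id prE Gu) (component_sum prB) (klin_sum qL) => /eqP.
rewrite subr_eq0 => /eqP-> ; rewrite summxE => nz.
have [i]: exists i, q (pr n ((q u 0 i)%:MP *: f i)) 0 a != 0.
  apply/existsP; apply: contraNT nz => /existsPn nz.
  by rewrite big1 // => i _; apply/eqP/negPn.
have C0 c : (c%:MP : {mpoly k[m]}) \is 0.-homog.
  by rewrite -alg_mpolyC dhomogZ ?dhomog1.
rewrite (prE _ _ _ (grading_scale gr (C0 _) (fG i))) add0r.
case: (deg i =P n) => [<-|_]; last by rewrite (klin0 qL) mxE eqxx.
rewrite (klinZ qL) qf !mxE.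
by case: (a =P i) => [->//|_]; rewrite andbF mulr0 eqxx.
Qed.
End HomogeneousCoordinates.

(** * Parametrized spaces of homomorphisms and maps out of free modules *)

(** A complement of the space [L] of parameters of the zero map parametrizes the
    homomorphisms bijectively, and its basis gives one of the homomorphisms. *)
Lemma hom_dim_of_param (k : fieldType) (m : nat) (V W : lmodType {mpoly k[m]})
    (U : vectType k) (theta : U -> {linear V -> W}) (L : {vspace U}) :
  (forall c u u' v, theta (c *: u + u') v = c%:MP *: theta u v + theta u' v) ->
  (forall h : {linear V -> W}, exists u, forall v, h v = theta u v) ->
  (forall u, (forall v, theta u v = 0) <-> u \in L) ->
  hom_dim V W (\dim {:U} - \dim L).
Proof.
move=> thL thS thK; rewrite -dimv_compl.
have thD u u' v : theta (u + u') v = theta u v + theta u' v.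
  by have := thL 1 u u' v; rewrite mpolyC1 !scale1r.
have th0 v : theta 0 v = 0 by apply: (thK 0).2; exact: mem0v.
have thZ c u v : theta (c *: u) v = c%:MP *: theta u v.
  by rewrite -[c *: u]addr0 thL th0 addr0.
have th_sum n (c : 'rV[k]_n) (w : 'I_n -> U) v :
    theta (\sum_(i < n) c 0 i *: w i) v = \sum_(i < n) (c 0 i)%:MP *: theta (w i) v.
  elim: n c w => [|n IHn] c w; first by rewrite !big_ord0.
  rewrite !big_ord_recl thD thZ; congr (_ + _).
  have := IHn (\row_i c 0 (lift ord0 i)) (fun i => w (lift ord0 i)).
  rewrite (eq_bigr (fun i => c 0 (lift ord0 i) *: w (lift ord0 i))).
    by move=> ->; apply: eq_bigr => i _; rewrite mxE.
  by move=> i _; rewrite mxE.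
exists (fun i => theta (vbasis L^C)`_i) => h.
have [u hu] := thS h.
have /memv_addP[u1 Lu1 [u2 Cu2 eu]] : u \in (L + L^C)%VS.
  by rewrite addv_complf memvf.
have hu2 v : h v = theta u2 v by rewrite hu eu thD (thK u1).2 ?add0r.
exists (\row_i coord (vbasis L^C) i u2); split=> [v|c hc].
  rewrite hu2 {1}(coord_vbasis Cu2).
  rewrite (eq_bigr (fun i => (\row_i coord (vbasis L^C) i u2) 0 i *: (vbasis L^C)`_i)).
    by rewrite th_sum.
  by move=> i _; rewrite mxE.
pose u3 := \sum_i c 0 i *: (vbasis L^C)`_i.
have Cu3 : u3 \in (L^C)%VS.
  by apply: memv_suml => i _; rewrite memvZ // vbasis_mem // mem_nth // size_tuple.
have e23 : u2 = u3.
  apply/eqP; rewrite -subr_eq0 -memv0 -(capv_compl L) memv_cap.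
  rewrite (memvB Cu2 Cu3) andbT; apply/thK => v.
  rewrite addrC -scaleN1r thL -hu2 hc th_sum.
  by rewrite rmorphN rmorph1 scaleN1r addNr.
apply/rowP => i; rewrite mxE e23 coord_sum_free //.
exact: basis_free (vbasisP _).
Qed.

(** Commuting values [T i] in a noncommutative ring [S], such as the commuting
    matrices below, which need not be central. *)
Lemma mmap1D (m : nat) (S : nzRingType) (T : 'I_m -> S) (m1 m2 : 'X_{1..m}) :
  (forall i j, GRing.comm (T i) (T j)) ->
  mmap1 T (m1 + m2)%MM = mmap1 T m1 * mmap1 T m2.
Proof.
move=> TC; rewrite /mmap1; elim: (index_enum _) => [|i s IHs].
  by rewrite !big_nil mulr1.
rewrite !big_cons {}IHs mnmDE exprD -!mulrA; congr (_ * _).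
rewrite !mulrA; congr (_ * _); apply: commr_prod => j _.
by apply/commrX/commr_sym/commrX.
Qed.

(** Commuting matrices [T] turn [k^n] into an S-module of row vectors, and this
    is the universal property of the free module [F] towards it. *)
Lemma free_klinear_ext (k : fieldType) (m n r : nat) (F : lmodType {mpoly k[m]})
    (e : 'I_r -> F) (T : 'I_m -> 'M[k]_n) (w : 'I_r -> 'rV[k]_n) :
  is_basis e -> (forall i j, T i *m T j = T j *m T i) ->
  exists Psi : F -> 'rV[k]_n, [/\ klinear Psi,
    forall j v, Psi ('X_j *: v) = Psi v *m T j & forall i, Psi (e i) = w i].
Proof.
case: n T w => [|n] T w be TC.
  exists (fun=> 0); split=> [c u v|j v|i]; last by rewrite [w i]thinmx0.
    by rewrite scaler0 addr0.
  by rewrite mul0mx.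
pose ev := mmap (@scalar_mx k n.+1) T.
have evZ c p : ev (c%:MP * p) = c *: ev p.
  by rewrite mul_mpolyC /ev mmapZ -mul_scalar_mx.
have evX j p : ev ('X_j * p) = ev p *m T j.
  elim/mpolyind: p => [|c mo p _ _ IHp]; first by rewrite mulr0 /ev mmap0 mul0mx.
  rewrite mulrDr /ev !mmapD -/ev {}IHp mulmxDl; congr (_ + _).
  rewrite -!mul_mpolyC mulrCA !evZ -scalemxAl; congr (_ *: _).
  by rewrite mulrC -mpolyXD /ev !mmapX mmap1D ?mmap1U //.
have [c cP] := ClassicalEpsilon.choice _ be.
have cE v : v = \sum_(i < r) c v 0 i *: e i by case: (cP v).
have cU v (a : 'rV_r) : v = \sum_(i < r) a 0 i *: e i -> c v = a.
  by case: (cP v) => _; apply.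
have cL p u v : c (p *: u + v) = p *: c u + c v.
  apply: cU; rewrite {1}[u]cE {1}[v]cE scaler_sumr -big_split /=.
  by apply: eq_bigr => i _; rewrite !mxE scalerDl scalerA.
have c0 : c 0 = 0 by apply: cU; rewrite big1 // => i _; rewrite mxE scale0r.
have ce i : c (e i) = delta_mx 0 i.
  apply: cU; rewrite (bigD1 i) //= mxE !eqxx scale1r big1 ?addr0 // => j ne.
  by rewrite mxE (negPf ne) andbF scale0r.
exists (fun v => \sum_(i < r) w i *m ev (c v 0 i)); split=> [a u v|j v|i].
- rewrite scaler_sumr -big_split /=; apply: eq_bigr => i _.
  by rewrite cL !mxE /ev mmapD -/ev evZ mulmxDr scalemxAr.
- rewrite mulmx_suml; apply: eq_bigr => i _.
  by rewrite -[_ *: v]addr0 cL c0 addr0 mxE evX mulmxA.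
- rewrite (bigD1 i) //= ce mxE !eqxx /ev mmapC mul_mx_scalar scale1r.
  rewrite big1 ?addr0 // => j ne.
  by rewrite mxE (negPf ne) andbF mmap0 mulmx0.
Qed.

Lemma free_klinear_unique (k : fieldType) (m n r : nat)
    (F : lmodType {mpoly k[m]}) (e : 'I_r -> F) (T : 'I_m -> 'M[k]_n)
    (Psi : F -> 'rV[k]_n) :
  is_basis e -> klinear Psi -> (forall j v, Psi ('X_j *: v) = Psi v *m T j) ->
  (forall i, Psi (e i) = 0) -> forall v, Psi v = 0.
Proof.
move=> be PL PX Pe v; have [c [-> _]] := be v.
rewrite (klin_sum PL) big1 // => i _.
elim/mpoly_var_ind: (c 0 i) => [a|p q IHp IHq|j p IHp].
- by rewrite (klinZ PL) Pe scaler0.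
- by rewrite scalerDl (klinD PL) IHp IHq addr0.
- by rewrite -scalerA PX IHp mul0mx.
Qed.

(** * First-order deformations and homomorphisms from K to F / K *)

(** The map [q] gives coordinates of [F / K] lifted to [F], with kernel [K];
    the [f a] lift its coordinate basis, and [X j] is the matrix of ['X_j]
    acting on row vectors. *)
Section Deformation.
Context (k : fieldType) (m r d : nat) (F : lmodType {mpoly k[m]}).
Context (e : 'I_r -> F) (K : submodClosed F).
Context (q : F -> 'rV[k]_d) (f : 'I_d -> F) (X : 'I_m -> 'M[k]_d).
Hypothesis be : is_basis e.
Hypothesis qL : klinear q.
Hypothesis qK : forall v, q v = 0 <-> v \in K.
Hypothesis qf : forall a, q (f a) = delta_mx 0 a.
Hypothesis qX : forall j v, q ('X_j *: v) = q v *m X j.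

Lemma mx_coord_ext (A B : 'M[k]_d) : (forall v, q v *m A = q v *m B) -> A = B.
Proof.
by move=> AB; apply/row_matrixP => a; have := AB (f a); rewrite qf -!rowE.
Qed.

Lemma coord_mxC i j : X i *m X j = X j *m X i.
Proof.
by apply: mx_coord_ext => v; rewrite !mulmxA -!qX !scalerA mulrC.
Qed.

(** Equivalently [[X i, A j] = [X j, A i]]: the matrices [X i + eps A i] over the
    dual numbers commute. These are the 1-cocycles of the
    Koszul complex of End(F / K). *)
Definition cocycle (A : 'I_m -> 'M[k]_d) : Prop :=
  forall i j, X i *m A j + A i *m X j = X j *m A i + A j *m X i.

(** [q + eps Phi] is the map from [F] to the deformed module over the dual
    numbers that sends [e i] to [q (e i) + eps w i]. On [K], where [q]
    vanishes, [Phi] is S-linear. *)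
Definition deforms (A : 'I_m -> 'M[k]_d) (w : 'I_r -> 'rV[k]_d)
    (Phi : F -> 'rV[k]_d) : Prop :=
  [/\ klinear Phi, forall j v, Phi ('X_j *: v) = Phi v *m X j + q v *m A j &
      forall i, Phi (e i) = w i].

(** The deformed module has the commuting block matrices [[X, A], [0, X]], and
    the universal property of [F] applies to it. *)
Lemma deforms_exists A w : cocycle A -> exists Phi, deforms A w Phi.
Proof.
move=> cA; pose T i := block_mx (X i) (A i) 0 (X i) : 'M_(d + d).
have TC i j : T i *m T j = T j *m T i.
  rewrite !mulmx_block !mul0mx !mulmx0 !addr0 !add0r cA.
  by rewrite (coord_mxC i j).
have [Psi [PL PX Pe]] := free_klinear_ext (fun i => row_mx (q (e i)) (w i)) be TC.
have lL : klinear (lsubmx \o Psi) by move=> c u v; rewrite /= PL linearP.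
have rL : klinear (rsubmx \o Psi) by move=> c u v; rewrite /= PL linearP.
have PlX j v : lsubmx (Psi ('X_j *: v)) = lsubmx (Psi v) *m X j.
  by rewrite PX -{1}[Psi v]hsubmxK mul_row_block row_mxKl mulmx0 addr0.
have lq v : lsubmx (Psi v) = q v.
  apply/eqP; rewrite -subr_eq0; apply/eqP; move: v.
  apply: (@free_klinear_unique _ _ _ _ _ _ X
    (fun v => lsubmx (Psi v) - q v) be) => [c u v|j v|i].
  - by rewrite qL -[lsubmx _]/((lsubmx \o Psi) _) lL /= scalerBr opprD addrACA.
  - by rewrite PlX qX mulmxBl.
  - by rewrite Pe row_mxKl subrr.
exists (rsubmx \o Psi); split=> // [j v|i] /=; last by rewrite Pe row_mxKr.
by rewrite PX -{1}[Psi v]hsubmxK mul_row_block row_mxKr lq addrC.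
Qed.

Lemma deforms_unique A w Phi Phi' :
  deforms A w Phi -> deforms A w Phi' -> Phi =1 Phi'.
Proof.
move=> [PL PX Pe] [QL QX Qe] v; apply/eqP; rewrite -subr_eq0; apply/eqP; move: v.
apply: (@free_klinear_unique _ _ _ _ _ _ X
  (fun v => Phi v - Phi' v) be) => [c u v|j v|i].
- by rewrite PL QL scalerBr opprD addrACA.
- by rewrite PX QX opprD addrACA subrr addr0 mulmxBl.
- by rewrite Pe Qe subrr.
Qed.

Lemma deforms_linear c A w Phi A' w' Phi' :
  deforms A w Phi -> deforms A' w' Phi' ->
  deforms (fun j => c *: A j + A' j) (fun i => c *: w i + w' i)
    (fun v => c *: Phi v + Phi' v).
Proof.
move=> [PL PX Pe] [QL QX Qe]; split=> [a u v|j v|i].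
- rewrite PL QL !scalerDr !scalerA (mulrC c a) !addrA; congr (_ + _).
  by rewrite addrAC.
- rewrite PX QX mulmxDl mulmxDr scalerDr -!scalemxAl -!scalemxAr.
  by rewrite addrACA.
- by rewrite Pe Qe.
Qed.

(** An infinitesimal change of basis [1 + eps g] gives a trivial deformation,
    for which [Phi] vanishes on [K]. *)
Lemma deforms_inner (g : 'M[k]_d) :
  deforms (fun j => X j *m g - g *m X j) (fun i => q (e i) *m g)
    (fun v => q v *m g).
Proof.
split=> // [c u v|j v]; first by rewrite qL mulmxDl scalemxAl.
by rewrite qX mulmxBr !mulmxA addrCA subrr addr0.
Qed.

Lemma inner_cocycle (g : 'M[k]_d) : cocycle (fun j => X j *m g - g *m X j).
Proof.
move=> i j; rewrite !mulmxBl !mulmxBr !mulmxA (coord_mxC i j).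
rewrite -[g *m X i *m X j]mulmxA (coord_mxC i j) mulmxA.
by rewrite addrA subrK addrA subrK.
Qed.

Definition lift_coord (c : 'rV[k]_d) : F := \sum_(a < d) (c 0 a)%:MP *: f a.

Local Notation s c := (quot_proj K (lift_coord c)).

Lemma coord_lift c : q (lift_coord c) = c.
Proof.
rewrite (klin_sum qL) [RHS]row_sum_delta; apply: eq_bigr => a _.
by rewrite (klinZ qL) qf.
Qed.

Lemma proj_coord v : quot_proj K v = s (q v).
Proof. by apply/quot_projP/qK; rewrite (klinB qL) coord_lift subrr. Qed.

Lemma proj_lin a c c' : s (a *: c + c') = a%:MP *: s c + s c'.
Proof.
rewrite -linearZ -linearD /=; apply/quot_projP/qK.
by rewrite (klinB qL) qL !coord_lift subrr.
Qed.

Lemma projX j c : s (c *m X j) = 'X_j *: s c.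
Proof.
rewrite -linearZ /=; apply/quot_projP/qK.
by rewrite (klinB qL) qX !coord_lift subrr.
Qed.

Lemma proj0 : s 0 = 0.
Proof. by rewrite -(klin0 qL) -proj_coord linear0. Qed.

Lemma proj_inj c c' : s c = s c' -> c = c'.
Proof.
by move/quot_projP/qK; rewrite (klinB qL) !coord_lift => /eqP;
  rewrite subr_eq0 => /eqP.
Qed.

Lemma deforms_hom A w Phi : deforms A w Phi ->
  exists h : {linear submod_type K -> quot_mod K},
    forall v : submod_type K, h v = s (Phi (\val v)).
Proof.
move=> [PL PX _].
have sD c c' : s (c + c') = s c + s c'.
  by rewrite -[c]scale1r proj_lin mpolyC1 !scale1r.
have hZ p (v : F) : v \in K -> s (Phi (p *: v)) = p *: s (Phi v).
  move=> Kv; elim/mpoly_var_ind: p => [c|p p' IHp IHp'|j p IHp].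
  - by rewrite (klinZ PL) -[c *: _]addr0 proj_lin proj0 addr0.
  - by rewrite scalerDl (klinD PL) sD IHp IHp' scalerDl.
  - rewrite -scalerA PX (qK _).2 ?rpredZ // mul0mx addr0 projX IHp.
    by rewrite scalerA.
have hL : linear (fun v : submod_type K => s (Phi (\val v))).
  move=> p u v; have -> : \val (p *: u + v) = p *: \val u + \val v by [].
  by rewrite (klinD PL) sD hZ //; case: (u).
pose h : {linear submod_type K -> quot_mod K} :=
  HB.pack (fun v : submod_type K => s (Phi (\val v)))
    (GRing.isLinear.Build _ _ _ _ _ hL).
by exists h.
Qed.

(** Every homomorphism [h] comes from a deformation: extend it by zero on the
    span of the lifts [f a], a linear complement of [K]. The extension fails to
    commute with ['X_j] by a map that factors through [F / K], whose matrix
    is [A j]. *)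
Lemma hom_deforms (h : {linear submod_type K -> quot_mod K}) :
  exists A w Phi, [/\ cocycle A, deforms A w Phi &
    forall v : submod_type K, h v = s (Phi (\val v))].
Proof.
have inK v : v - lift_coord (q v) \in K.
  by apply/quot_projP; rewrite -proj_coord.
pose toK v : submod_type K := SubmodType (inK v).
have toK_lift c : toK (lift_coord c) = 0.
  by apply: val_inj; rewrite /= coord_lift subrr.
have toK_id (v : submod_type K) : toK (\val v) = v.
  apply: val_inj; rewrite /= (qK _).2; last by case: v.
  by rewrite /lift_coord big1 ?subr0 // => a _; rewrite mxE mpolyC0 scale0r.
have lift_lin a c c' : lift_coord (a *: c + c') = a%:MP *: lift_coord c + lift_coord c'.
  rewrite scaler_sumr -big_split /=; apply: eq_bigr => b _.
  by rewrite !mxE rmorphD rmorphM /= scalerDl scalerA.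
have coordP (x : quot_mod K) : exists c, s c = x.
  by have [v ->] := quot_proj_surj x; exists (q v); rewrite -proj_coord.
have [t tP] := ClassicalEpsilon.choice _ coordP.
pose Phi v := t (h (toK v)).
have sPhi v : s (Phi v) = h (toK v) by exact: tP.
have PL : klinear Phi.
  move=> c u v; apply: proj_inj; rewrite proj_lin !sPhi -linearP.
  congr (h _); apply: val_inj.
  by rewrite [RHS]linearP /= qL lift_lin scalerBr opprD addrACA.
have PK (v : submod_type K) : h v = s (Phi (\val v)) by rewrite sPhi toK_id.
have Plift c : Phi (lift_coord c) = 0.
  by apply: proj_inj; rewrite sPhi toK_lift linear0 proj0.
pose A j := \matrix_(a < d) Phi ('X_j *: f a).
have PX j v : Phi ('X_j *: v) = Phi v *m X j + q v *m A j.
  have -> : Phi v = Phi (\val (toK v)) by rewrite /= (klinB PL) Plift subr0.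
  rewrite -{1}[v](subrK (lift_coord (q v))) scalerDr (klinD PL); congr (_ + _).
    apply: proj_inj; rewrite projX -PK -linearZ.
    by rewrite -[_ - _]/(\val (toK v)) -linearZ -PK.
  rewrite scaler_sumr (klin_sum PL) mulmx_sum_row; apply: eq_bigr => a _.
  by rewrite rowK scalerA mulrC -scalerA (klinZ PL).
exists A, (fun i => Phi (e i)), Phi; split=> // i j.
apply: mx_coord_ext => v.
apply: (addrI (Phi v *m (X i *m X j))).
rewrite {2}(coord_mxC i j) !mulmxDr !mulmxA.
(* The cocycle condition expresses that the two variables commute on [F]. *)
have : Phi ('X_i *: ('X_j *: v)) = Phi ('X_j *: ('X_i *: v)).
  by rewrite !scalerA mulrC.
rewrite !PX !qX !mulmxDl => E.
by rewrite [in LHS](addrC (q v *m X i *m A j)) [in RHS](addrC (q v *m X j *m A i))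
  !addrA E.
Qed.

(** Dimension count in the exact sequence
    0 -> End_k(F / K) -> Z x (F / K)^r -> Hom_S(K, F / K) -> 0, whose first map
    sends [g] to the commutators of the [X j] with [g] and the images by [g] of
    the classes of the [e i], and whose second map restricts [Phi]
    to [K]. The first map is injective because the [e i] generate. *)
Lemma hom_dim_cocycles (Z : {vspace {ffun 'I_m -> 'M[k]_d}}) :
  (forall A, A \in Z <-> cocycle A) ->
  exists n, hom_dim (submod_type K) (quot_mod K) n /\
    (n + d * d = r * d + \dim Z)%N.
Proof.
move=> ZP.
pose U : vectType k := (subvs_of Z * 'M[k]_(r, d))%type.
have ex (u : U) : exists h : {linear submod_type K -> quot_mod K},
    exists Phi, deforms (vsval u.1) (fun i => row i u.2) Phi /\
      forall v, h v = s (Phi (\val v)).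
  have /ZP cu : vsval u.1 \in Z by exact: subvsP.
  have [Phi dPhi] := deforms_exists (fun i => row i u.2) cu.
  by have [h hP] := deforms_hom dPhi; exists h, Phi.
have [theta] := ClassicalEpsilon.choice _ ex.
case/ClassicalEpsilon.choice=> Phi thP.
have dP (u : U) : deforms (vsval u.1) (fun i => row i u.2) (Phi u) by case: (thP u).
have thE u v : theta u v = s (Phi u (\val v)) by case: (thP u).
(* The embedding of End_k(F / K) by infinitesimal changes of basis. *)
pose inner (g : 'M[k]_d) : U :=
  (vsproj Z [ffun j => X j *m g - g *m X j], \matrix_i (q (e i) *m g)).
have innerL : linear inner.
  move=> c g g'; rewrite /inner.
  have -> : [ffun j => X j *m (c *: g + g') - (c *: g + g') *m X j] =
      c *: [ffun j => X j *m g - g *m X j] + [ffun j => X j *m g' - g' *m X j].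
    apply/ffunP => j; rewrite !ffunE mulmxDl mulmxDr -scalemxAl -scalemxAr.
    by rewrite scalerBr opprD addrACA.
  have -> : \matrix_i (q (e i) *m (c *: g + g')) =
      c *: (\matrix_i (q (e i) *m g)) + \matrix_i (q (e i) *m g').
    by apply/row_matrixP => i; rewrite linearP /= !rowK mulmxDr scalemxAr.
  by rewrite linearP.
pose E : {linear 'M[k]_d -> U} := HB.pack inner (GRing.isLinear.Build _ _ _ _ _ innerL).
have E1 g j : vsval (inner g).1 j = X j *m g - g *m X j.
  rewrite /= vsprojK ?ffunE //; apply/ZP => i i'; rewrite !ffunE.
  exact: inner_cocycle.
have PhiE g : Phi (inner g) =1 (fun v => q v *m g).
  apply: (deforms_unique (dP _)).
  have [PL PX Pe] := deforms_inner g; split=> // [j u|i].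
    by rewrite E1 PX.
  by rewrite rowK.
pose L := limg (linfun E).
have dimL : \dim L = (d * d)%N.
  rewrite limg_dim_eq ?dimvf //.
  apply/eqP; rewrite capfv; apply/lker0P => g g'.
  rewrite !lfunE /= => eg; apply: mx_coord_ext => v.
  by rewrite -!PhiE eg.
exists (\dim {:U} - \dim L)%N; split.
  apply: (@hom_dim_of_param _ _ _ _ U theta L) => [c u u' v|h|u].
  - rewrite !thE -proj_lin; congr (s _).
    apply: (deforms_unique (dP _)
      (Phi' := fun x => c *: Phi u x + Phi u' x)).
    have [PL PX Pe] := deforms_linear c (dP u) (dP u'); split=> // [j x|i].
      by rewrite PX /= !ffunE.
    by rewrite Pe /= linearP.
  - have [A [w [Psi [cA dPsi hPsi]]]] := hom_deforms h.
    have ZA : [ffun j => A j] \in Z.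
      by apply/ZP => i j; rewrite !ffunE; apply: cA.
    exists (vsproj Z [ffun j => A j], \matrix_i w i) => v.
    rewrite hPsi thE; congr (s _).
    apply: (deforms_unique dPsi).
    have [PL PX Pe] := dP (vsproj Z [ffun j => A j], \matrix_i w i).
    split=> // [j x|i]; first by rewrite PX /= vsprojK ?ffunE.
    by rewrite Pe /= rowK.
  - split=> [th0|].
      (* Vanishing on [K], [Phi u] factors through [q], by the matrix [g]. *)
      pose g := \matrix_a Phi u (f a).
      have [PL PX Pe] := dP u.
      have Pg v : Phi u v = q v *m g.
        have Kv : v - lift_coord (q v) \in K.
          by apply/quot_projP; rewrite -proj_coord.
        have := th0 (SubmodType Kv); rewrite thE /= -proj0 => /proj_inj/eqP.
        rewrite (klinB PL) subr_eq0 => /eqP->.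
        rewrite (klin_sum PL) mulmx_sum_row; apply: eq_bigr => a _.
        by rewrite rowK (klinZ PL).
      apply/memv_imgP; exists g; rewrite ?memvf // lfunE /=.
      have u1 : u.1 = (inner g).1.
        apply: subvs_inj; apply/ffunP => j; rewrite E1.
        apply: mx_coord_ext => v; apply: (addrI (Phi u v *m X j)).
        by rewrite -PX !Pg qX mulmxBr !mulmxA addrCA subrr addr0.
      have u2 : u.2 = (inner g).2.
        by apply/row_matrixP => i; rewrite rowK -Pe Pg.
      by case: (u) u1 u2 => ? ? /= -> ->.
    move=> /memv_imgP[g _]; rewrite lfunE /= => -> v.
    by rewrite thE PhiE (qK _).2 ?mul0mx ?proj0 //; case: v.
rewrite -dimL subnK ?dimvS ?subvf // dimvf.
have -> : dim U = (\dim Z + dim (matrix k r d))%N by [].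
by rewrite dim_matrix addnC.
Qed.
End Deformation.

(** * Symmetric matrices of even rank *)

(** Ordering the indices by [s] makes [C] block antidiagonal, with
    blocks [B] and [B^T], so its rank is twice that of [B]. In the proof [P] is
    the projection on the indices with [s i], and the blocks are [P C] and [C P]. *)
Lemma even_rank_bicolored (k : fieldType) (N : nat) (C : 'M[k]_N)
    (s : 'I_N -> bool) :
  C^T = C -> (forall i j, C i j != 0 -> s i != s j) -> ~~ odd (\rank C).
Proof.
move=> Csym Cs.
pose P : 'M[k]_N := diag_mx (\row_i (s i)%:R).
have eC (i j : 'I_N) : C i j * (s j)%:R = C i j - (s i)%:R * C i j.
  have [->|/Cs] := eqVneq (C i j) 0; first by rewrite mul0r mulr0 subr0.
  by case: (s i); case: (s j) => // _;
    rewrite ?(mulr0, mulr1, mul0r, mul1r) ?subrr ?subr0.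
have CP : C *m P = C - P *m C.
  by apply/matrixP => i j; rewrite mul_mx_diag mul_diag_mx !mxE eC.
have PT : P^T = P by rewrite tr_diag_mx.
have PP : P *m P = P.
  apply/matrixP => i j; rewrite mul_diag_mx !mxE.
  by case: (s i); rewrite ?(mul1r, mul0r) // mul0rn.
have dec : C = P *m C + C *m P by rewrite CP addrC subrK.
have PCP : P *m C *m P = 0.
  by rewrite -mulmxA CP mulmxBr mulmxA PP subrr.
have disj : (P *m C :&: C *m P = 0)%MS.
  apply/eqP/rowV0P => v; rewrite sub_capmx => /andP[/submxP[x vx] /submxP[y vy]].
  have <- : v *m P = v by rewrite {1}vy -!mulmxA PP -vy.
  by rewrite vx -mulmxA PCP mulmx0.
have eqC : (C :=: P *m C + C *m P)%MS.
  apply/eqmxP/andP; split; first by rewrite {1}dec addmx_sub_adds.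
  by rewrite addsmx_sub submxMl CP addmx_sub ?eqmx_opp ?submxMl.
rewrite eqC (mxrank_disjoint_sum disj) -[\rank (C *m P)]mxrank_tr trmx_mul PT Csym.
by rewrite addnn odd_double.
Qed.

Lemma trace_delta_mul (k : fieldType) (d : nat) (a b : 'I_d) (M : 'M[k]_d) :
  \tr (delta_mx a b *m M) = M b a.
Proof.
rewrite /mxtrace (bigD1 a) //= big1 ?addr0 => [|i ne].
  rewrite mxE (bigD1 b) //= big1 ?addr0 => [|j ne]; first by rewrite mxE !eqxx mul1r.
  by rewrite mxE (negPf ne) andbF mul0r.
by rewrite mxE big1 // => j _; rewrite mxE (negPf ne) mul0r.
Qed.

(** * The curl form on triples of endomorphisms *)

Section Curl.
Context (k : fieldType) (d : nat) (X : 'I_3 -> 'M[k]_d).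

Let o0 : 'I_3 := @Ordinal 3 0 isT.
Let o1 : 'I_3 := @Ordinal 3 1 isT.
Let o2 : 'I_3 := @Ordinal 3 2 isT.

Definition bracket (i : 'I_3) (A : 'M[k]_d) : 'M[k]_d := X i *m A - A *m X i.

(** The pairing of [B] with the curl of [A], that is, with the differential
    End^3 -> End^3 of the Koszul complex, under the trace form. *)
Definition curl_form (B A : {ffun 'I_3 -> 'M[k]_d}) : k :=
  \tr (B o0 *m (bracket o1 (A o2) - bracket o2 (A o1)))
  + \tr (B o1 *m (bracket o2 (A o0) - bracket o0 (A o2)))
  + \tr (B o2 *m (bracket o0 (A o1) - bracket o1 (A o0))).

Lemma trace_bracketC i (A B : 'M[k]_d) :
  \tr (B *m bracket i A) = - \tr (A *m bracket i B).
Proof.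
rewrite /bracket !mulmxBr !linearB /= opprB [\tr (B *m (A *m _))]mxtrace_mulC.
by rewrite [\tr (A *m (B *m _))]mxtrace_mulC -!mulmxA addrC
  [\tr (B *m (X i *m A))]mxtrace_mulC -!mulmxA addrC.
Qed.

(** The curl is self-adjoint: commutation with [X i] is skew for the trace form,
    and the coefficients of the curl are alternating in the three indices, so
    that exchanging [A] and [B] produces two cancelling signs. *)
Lemma curl_form_sym A B : curl_form B A = curl_form A B.
Proof.
have tB (M N N' : 'M[k]_d) : \tr (M *m (N - N')) = \tr (M *m N) - \tr (M *m N').
  by rewrite mulmxBr linearB.
rewrite /curl_form (tB _ (bracket o1 _) (bracket o2 _)).
rewrite (tB _ (bracket o2 _) (bracket o0 _)) (tB _ (bracket o0 _) (bracket o1 _)).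
rewrite (tB _ (bracket o1 _) (bracket o2 _)).
rewrite (tB _ (bracket o2 _) (bracket o0 _)) (tB _ (bracket o0 _) (bracket o1 _)).
rewrite (trace_bracketC o1 (A o2)) (trace_bracketC o2 (A o1)).
rewrite (trace_bracketC o2 (A o0)) (trace_bracketC o0 (A o2)).
rewrite (trace_bracketC o0 (A o1)) (trace_bracketC o1 (A o0)).
ring.
Qed.

Lemma curl_form_linear c B B' A :
  curl_form (c *: B + B') A = c * curl_form B A + curl_form B' A.
Proof.
rewrite /curl_form !ffunE !mulmxDl -!scalemxAl !linearD !linearZ /=.
ring.
Qed.

Definition unit_triple (t : 'I_3 * ('I_d * 'I_d)) : {ffun 'I_3 -> 'M[k]_d} :=
  [ffun l => if l == t.1 then delta_mx t.2.1 t.2.2 else 0].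

(** The trace form is nondegenerate, so the kernel of the form is that of the
    curl, which consists of the cocycles. *)
Lemma cocycle_curl_form (A : {ffun 'I_3 -> 'M[k]_d}) :
  cocycle X A <-> forall t, curl_form (unit_triple t) A = 0.
Proof.
have brP i j : X i *m A j + A i *m X j = X j *m A i + A j *m X i <->
    bracket i (A j) - bracket j (A i) = 0.
  rewrite /bracket opprB addrACA -opprD [A j *m X i + _]addrC.
  by split=> [->|/subr0_eq //]; rewrite subrr.
have unitE i a b : curl_form (unit_triple (i, (a, b))) A =
   (if i == o0 then bracket o1 (A o2) - bracket o2 (A o1)
    else if i == o1 then bracket o2 (A o0) - bracket o0 (A o2)
    else bracket o0 (A o1) - bracket o1 (A o0)) b a.
  rewrite /curl_form !ffunE /=.
  case: i => [[|[|[|//]]] ?]; rewrite -?[_ == _]/true -?[_ == _]/false /=;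
    by rewrite !mul0mx mxtrace0 trace_delta_mul ?addr0 ?add0r.
split=> [cA [i [a b]]|cA i j].
  by rewrite unitE; do 2?case: ifP => _; rewrite (brP _ _).1 ?mxE.
have c12 : bracket o1 (A o2) - bracket o2 (A o1) = 0.
  apply/matrixP => b a; have := cA (o0, (a, b)).
  by rewrite unitE /= => ->; rewrite mxE.
have c20 : bracket o2 (A o0) - bracket o0 (A o2) = 0.
  apply/matrixP => b a; have := cA (o1, (a, b)).
  by rewrite unitE /= => ->; rewrite mxE.
have c01 : bracket o0 (A o1) - bracket o1 (A o0) = 0.
  apply/matrixP => b a; have := cA (o2, (a, b)).
  by rewrite unitE /= => ->; rewrite mxE.
have ordE (l : 'I_3) : [\/ l = o0, l = o1 | l = o2].
  by case: l => [[|[|[|//]]] ?]; [apply: Or31|apply: Or32|apply: Or33]; apply: val_inj.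
by case: (ordE i) => ->; case: (ordE j) => -> //;
  solve [exact/brP | exact/esym/brP].
Qed.

Variable deg : 'I_d -> int.
Hypothesis Xdeg : forall i a b, X i a b != 0 -> deg b = deg a + 1.

(** The degree of the elementary endomorphism [delta_mx a b], which sends the
    basis vector [a] to the basis vector [b]. *)
Definition triple_deg (t : 'I_3 * ('I_d * 'I_d)) : int := deg t.2.2 - deg t.2.1.

Lemma trace_bracket_deg i a b a' b' :
  \tr (delta_mx a b *m bracket i (delta_mx a' b')) != 0 ->
  deg b - deg a + (deg b' - deg a') = -1.
Proof.
rewrite trace_delta_mul /bracket; pose D : 'M[k]_d := delta_mx a' b'.
have XD : (X i *m D) b a = X i b a' * (a == b')%:R.
  rewrite mxE (bigD1 a') //= big1 ?addr0 => [|j ne]; first by rewrite mxE eqxx.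
  by rewrite mxE (negPf ne) mulr0.
have DX : (D *m X i) b a = (b == a')%:R * X i b' a.
  rewrite mxE (bigD1 b') //= big1 ?addr0 => [|j ne].
    by rewrite mxE eqxx andbT.
  by rewrite mxE (negPf ne) andbF mul0r.
rewrite [X in X != 0]mxE [X in _ + X]mxE XD DX.
have [Xba|Xba] := eqVneq (X i b a' * (a == b')%:R) 0.
  rewrite Xba add0r oppr_eq0.
  have [->|_] := eqVneq b a'; last by rewrite mul0r eqxx.
  by rewrite mul1r => /Xdeg->; ring.
move: Xba; have [->|_] := eqVneq a b'; last by rewrite mulr0 eqxx.
by rewrite mulr1 => /Xdeg-> _; ring.
Qed.

(** The variables raise degrees by one and the trace only sees degree zero. *)
Lemma curl_form_deg t t' :
  curl_form (unit_triple t) (unit_triple t') != 0 ->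
  triple_deg t + triple_deg t' = -1.
Proof.
apply: contraNeq => ne.
have br0 i (l l' : 'I_3) : \tr (unit_triple t l *m bracket i (unit_triple t' l')) = 0.
  rewrite !ffunE; case: ifP => _; last by rewrite mul0mx mxtrace0.
  case: ifP => _; last by rewrite /bracket mul0mx mulmx0 subr0 mulmx0 mxtrace0.
  by apply/eqP; apply: contraNT ne => /trace_bracket_deg ->.
have tB (M N N' : 'M[k]_d) : \tr (M *m (N - N')) = \tr (M *m N) - \tr (M *m N').
  by rewrite mulmxBr linearB.
by rewrite /curl_form !(tB _ (bracket _ _) (bracket _ _)) !br0 !subr0 !addr0.
Qed.

(** Of two integers with sum [-1] exactly one is nonnegative: the Gram matrix [C] of the form is
    bicoloured by the sign of the degree, and its corank is congruent to its
    size [3 d^2]. *)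
Lemma cocycles_parity :
  exists Z : {vspace {ffun 'I_3 -> 'M[k]_d}},
    (forall A, A \in Z <-> cocycle X A) /\ (\dim Z = d * d %[mod 2])%N.
Proof.
pose T : finType := ('I_3 * ('I_d * 'I_d))%type.
pose C := \matrix_(i < #|T|, j < #|T|)
  curl_form (unit_triple (enum_val i)) (unit_triple (enum_val j)).
have even_C : ~~ odd (\rank C).
  apply: (@even_rank_bicolored _ _ C (fun i => 0 <= triple_deg (enum_val i))).
    by apply/matrixP => i j; rewrite !mxE curl_form_sym.
  move=> i j; rewrite mxE => /curl_form_deg.
  by move: (triple_deg _) (triple_deg _) => x y; lia.
(* Row vectors indexed by [T], as triples of matrices. *)
pose vec (u : 'rV[k]_#|T|) : {ffun 'I_3 -> 'M[k]_d} :=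
  [ffun l => \matrix_(a, b) u 0 (enum_rank ((l, (a, b)) : T))].
have vecL : linear vec.
  by move=> c u u'; apply/ffunP => l; apply/matrixP => a b; rewrite !(ffunE, mxE).
have vec_inj : injective vec.
  move=> u u' e; apply/rowP => i; rewrite -[i]enum_valK.
  case: (enum_val i) => l [a b].
  by move/ffunP/(_ l)/matrixP/(_ a b): e; rewrite !(ffunE, mxE).
have vec_surj A : exists u, A = vec u.
  exists (\row_i (let: (l, (a, b)) := enum_val i in A l a b)).
  by apply/ffunP => l; apply/matrixP => a b; rewrite !(ffunE, mxE) enum_rankK.
have vecE u : vec u = \sum_i u 0 i *: unit_triple (enum_val i).
  apply/ffunP => l; apply/matrixP => a b.
  rewrite sum_ffunE summxE (bigD1 (enum_rank ((l, (a, b)) : T))) //=.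
  rewrite !(ffunE, mxE) enum_rankK /= eqxx mxE !eqxx mulr1.
  rewrite big1 ?addr0 // => i ne; rewrite !(ffunE, mxE).
  have {ne} : enum_val i != (l, (a, b)).
    by apply: contra ne => /eqP <-; rewrite enum_valK.
  case: (enum_val i) => l' [a' b'] /=; rewrite !xpair_eqE.
  case: (eqVneq l l') => [_|_]; rewrite mxE ?mulr0 //=.
  by rewrite (eq_sym a) (eq_sym b) => /negPf->; rewrite mulr0.
have formE u A : curl_form (vec u) A =
    \sum_i u 0 i * curl_form (unit_triple (enum_val i)) A.
  rewrite vecE; elim/big_rec2: _ => [|i x y _ <-]; last by rewrite curl_form_linear.
  by have := curl_form_linear (-1) 0 0 A; rewrite scaler0 addr0 mulN1r addNr.
have vecC u : cocycle X (vec u) <-> u *m C = 0.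
  have -> : u *m C = \row_j curl_form (unit_triple (enum_val j)) (vec u).
    apply/rowP => j; rewrite !mxE curl_form_sym formE.
    by apply: eq_bigr => i _; rewrite mxE.
  rewrite cocycle_curl_form; split=> [c0|/rowP c0 t].
    by apply/rowP => j; rewrite !mxE.
  by have := c0 (enum_rank (t : T)); rewrite !mxE enum_rankK.
pose B := row_base (kermx C).
have alphaL : linear (fun y => vec (y *m B)).
  by move=> c y y'; rewrite mulmxDl -scalemxAl vecL.
pose alpha : {linear 'rV[k]_(\rank (kermx C)) -> {ffun 'I_3 -> 'M[k]_d}} :=
  HB.pack (fun y => vec (y *m B)) (GRing.isLinear.Build _ _ _ _ _ alphaL).
have alpha_inj : injective (linfun alpha).
  move=> y y'; rewrite !lfunE => /vec_inj.
  exact: (row_free_inj (row_base_free _)).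
exists (limg (linfun alpha)); split=> [A|].
  split=> [/memv_imgP[y _]|].
    rewrite lfunE => ->; apply/vecC; apply/sub_kermxP.
    by rewrite (submx_trans (submxMl _ _)) // eq_row_base.
  have [u ->] := vec_surj A => /vecC/sub_kermxP.
  rewrite -(eq_row_base (kermx C)) => /submxP[y ->].
  by apply/memv_imgP; exists y; rewrite ?memvf // lfunE.
rewrite limg_dim_eq; last by apply/eqP; rewrite capfv; apply/lker0P.
rewrite dimvf dim_matrix mul1r mxrank_ker.
rewrite !modn2 oddB ?rank_leq_row // (negbTE even_C) addbF.
by rewrite !card_prod !card_ord oddM.
Qed.
End Curl.

(** * Parity of the dimension of Hom_S(K, F / K) *)

Theorem theorem10 (k : closedFieldType) (F : lmodType {mpoly k[3]})
    (G : int -> {pred F}) (r : nat) (K : submodClosed F) (d : nat) :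
  graded_free G r ->
  graded_submod G K ->
  has_length (quot_mod K) d ->
  exists n : nat,
    hom_dim (submod_type K) (quot_mod K) n /\ (n = r * d %[mod 2])%N.
Proof.
move=> frG grK lenK; have [gr [e [be _]]] := frG.
have nilX (j : 'I_3) : exists N, forall x : quot_mod K, 'X_j ^+ N *: x = 0.
  by exists d; exact: (graded_finite_length_nilpotent j frG grK lenK).
have [b bP] := length_basis lenK nilX.
have [q0 [q0L q0K q0S]] := quotient_coordinates bP.
have [q [f [deg [qL qK qf fG qdeg]]]] := homogeneous_coordinates gr grK q0L q0K q0S.
pose X (j : 'I_3) := \matrix_(a < d) q ('X_j *: f a).
have qX j v : q ('X_j *: v) = q v *m X j.
  have : 'X_j *: (v - lift_coord f (q v)) \in K.
    by rewrite rpredZ //; apply/qK; rewrite (klinB qL) (coord_lift qL qf) subrr.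
  move/qK/eqP; rewrite scalerBr (klinB qL) subr_eq0 => /eqP->.
  rewrite scaler_sumr (klin_sum qL) mulmx_sum_row; apply: eq_bigr => a _.
  by rewrite rowK scalerA mulrC -scalerA (klinZ qL).
have Xdeg j a c : X j a c != 0 -> deg c = deg a + 1.
  rewrite mxE => nz; rewrite addrC; apply: qdeg nz.
  by apply: (grading_scale gr) (fG a); rewrite dhomogX /= mdeg1.
have [Z [ZP Zpar]] := cocycles_parity Xdeg.
have [n [hn en]] := hom_dim_cocycles be qL qK qf qX ZP.
exists n; split=> //.
(* Here [n + d^2 = r d + dim Z], with [dim Z] congruent to [d^2]. *)
have : (n + d * d = r * d + d * d %[mod 2])%N by rewrite en -modnDmr Zpar modnDmr.
by move/eqP; rewrite eqn_modDr => /eqP.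
Qed.
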